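(* Let the problem data, $\Sigma_0$, $P_f\succ 0$, symmetric positive definite matrices $P_0,\dots,P_N\in\mathbb R^{(1+n)\times(1+n)}$, controller gains $K_0,\dots,K_{N-1}\in\mathbb R^{m\times(1+n)}$ and a scalar $\nu>0$ be given as in the context. Define $$\widetilde P_k:=P_k^{-1},\quad \widetilde K_k:=K_kP_k^{-1},\quad \tilde\nu:=\nu^{-1},\quad Z:=\nu^{-2}\sqrt{\Sigma_0}\,P_0\sqrt{\Sigma_0},$$ partition $\widetilde P_k=\begin{pmatrix}\tilde p_k^{11}&\tilde p_k^{12}\\ \tilde p_k^{21}&\widetilde P_k^{22}\end{pmatrix}$ (with $\tilde p_k^{11}\in\mathbb R$, $\widetilde P_k^{22}\in\mathbb R^{n\times n}$), $\widetilde K_k=\begin{pmatrix}\tilde k_k^1&\widetilde K_k^2\end{pmatrix}$ (with $\tilde k_k^1\in\mathbb R^m$), and set $$\begin{pmatrix}\tilde f_k^K&\widetilde A_k^K\\ \tilde g_k^{1K}&\widetilde C_k^{1K}\\ \tilde g_{ki}^{2K}&\widetilde C_{ki}^{2K}\end{pmatrix}:=\begin{pmatrix}f_k&A_k&B_k^1\\ g_k^1&C_k^1&D_k^{11}\\ g_{ki}^2&C_{ki}^2&D_{ki}^{21}\end{pmatrix}\begin{pmatrix}\tilde p_k^{11}&\tilde p_k^{12}\\ \tilde p_k^{21}&\widetilde P_k^{22}\\ \tilde k_k^1&\widetilde K_k^2\end{pmatrix}.$$ Then the conditions (P1)-(P4), (P1) $E_k^\top\,\mathrm{diag}(-P_k,\,P_{k+1},\,I)\,E_k\preceq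 0$ with $E_k=\begin{pmatrix}1&0\\0&I\\1&0\\ f_k^K&A_k^K\\ g_k^{1K}&C_k^{1K}\end{pmatrix}$, for $k=0,\dots,N-1$; (P2) $\nu\ge \mathrm{trace}(P_0\Sigma_0)$; (P3) $P_N\succeq P_f$; (P4) $P_k\succeq \nu\begin{pmatrix}g_{ki}^{2K}&C_{ki}^{2K}\end{pmatrix}^\top\begin{pmatrix}g_{ki}^{2K}&C_{ki}^{2K}\end{pmatrix}$ for $k=0,\dots,N-1$, $i=1,\dots,s$; are equivalent to the conditions (L1)-(L4): (L1) $\begin{pmatrix}\tilde p_{k+1}^{11}&\tilde p_{k+1}^{12}&0&\tilde p_k^{11}&\tilde p_k^{12}\\ \tilde p_{k+1}^{21}&\widetilde P_{k+1}^{22}&0&\tilde f_k^K&\widetilde A_k^K\\ 0&0&I&\tilde g_k^{1K}&\widetilde C_k^{1K}\\ \tilde p_k^{11}&(\tilde f_k^K)^\top&(\tilde g_k^{1K})^\top&\tilde p_k^{11}&\tilde p_k^{12}\\ \tilde p_k^{21}&(\widetilde A_k^K)^\top&(\widetilde C_k^{1K})^\top&\tilde p_k^{21}&\widetilde P_k^{22}\end{pmatrix}\succeq0$ for $k=0,\dots,N-1$; (L2) $\begin{pmatrix}\widetilde P_0&\tilde\nu\sqrt{\Sigma_0}\\ \tilde\nu\sqrt{\Sigma_0}^\top&Z\end{pmatrix}\succeq0$ and $\mathrm{trace}\,Z\le\tilde\nu$; (L3) $\widetilde P_N\preceq P_f^{-1}$; (L4) $\begin{pmatrix}\tilde p_k^{11}&\tilde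 p_k^{12}&(\tilde g_{ki}^{2K})^\top\\ \tilde p_k^{21}&\widetilde P_k^{22}&(\widetilde C_{ki}^{2K})^\top\\ \tilde g_{ki}^{2K}&\widetilde C_{ki}^{2K}&\tilde\nu I\end{pmatrix}\succeq0$ for $k=0,\dots,N-1$, $i=1,\dots,s$.
   Context: Fix $N\in\mathbb N$, $n,m,s\in\mathbb N$. The data are real matrices/vectors of compatible sizes: $f_k\in\mathbb R^n$, $A_k\in\mathbb R^{n\times n}$, $B_k^1\in\mathbb R^{n\times m}$ (dynamics $x_{k+1}=f_k+A_kx_k+B_k^1u_k$); $g_k^1,C_k^1,D_k^{11}$ (performance output $y_k=g_k^1+C_k^1x_k+D_k^{11}u_k$); $g_{ki}^2,C_{ki}^2,D_{ki}^{21}$ (constraint outputs $v_{ki}=g_{ki}^2+C_{ki}^2x_k+D_{ki}^{21}u_k$), for $k=0,\dots,N-1$, $i=1,\dots,s$. Further, $P_f\in\mathbb R^{(1+n)\times(1+n)}$ is symmetric positive definite, $\bar x\in\mathbb R^n$ is the initial state, $\Sigma_0:=\begin{pmatrix}1\\ \bar x\end{pmatrix}\begin{pmatrix}1\\ \bar x\end{pmatrix}^\top$, and $\sqrt{\Sigma_0}$ is its positive semidefinite square root. The gain $K_k=\begin{pmatrix}k_k^1&K_k^2\end{pmatrix}$, $k_k^1\in\mathbb R^m$, $K_k^2\in\mathbb R^{m\times n}$, represents the affine policy $u_k=k_k^1+K_k^2x_k$, and the closed-loop matrices are $$\begin{pmatrix}f_k^K&A_k^K\\ g_k^{1K}&C_k^{1K}\\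 g_{ki}^{2K}&C_{ki}^{2K}\end{pmatrix}:=\begin{pmatrix}f_k&A_k&B_k^1\\ g_k^1&C_k^1&D_k^{11}\\ g_{ki}^2&C_{ki}^2&D_{ki}^{21}\end{pmatrix}\begin{pmatrix}1&0\\0&I\\ k_k^1&K_k^2\end{pmatrix}.$$ $\succeq,\preceq$ denote the Loewner (semidefinite) order on symmetric matrices. *)

(* Defs.v *)
From mathcomp Require Import all_boot all_order all_algebra.
From mathcomp Require Import reals.

Set Implicit Arguments.
Unset Strict Implicit.
Unset Printing Implicit Defensive.

Import Order.TTheory GRing.Theory Num.Theory.
Local Open Scope ring_scope.

(* Symmetry is part of semidefiniteness and definiteness, as usual for real
   matrices. *)
Definition psdmx (R : realType) (p : nat) (M : 'M[R]_p) : Prop :=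
  M \is symmetricmx /\ forall x : 'cV[R]_p, 0 <= (x^T *m M *m x) 0 0.

Definition pdmx (R : realType) (p : nat) (M : 'M[R]_p) : Prop :=
  M \is symmetricmx /\
  forall x : 'cV[R]_p, x != 0 -> 0 < (x^T *m M *m x) 0 0.

Definition loewner_le (R : realType) (p : nat) (M1 M2 : 'M[R]_p) : Prop :=
  psdmx (M2 - M1).

Notation "M1 '\preceq' M2" := (loewner_le M1 M2)
  (at level 70, no associativity) : ring_scope.

(* The positive semidefinite square root is unique when it exists, so this
   predicate pins down S. *)
Definition is_psd_sqrt (R : realType) (p : nat) (S M : 'M[R]_p) : Prop :=
  psdmx S /\ S *m S = M.

Definition Sigma0 (R : realType) (n : nat) (xbar : 'cV[R]_n) : 'M[R]_(1 + n) :=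
  col_mx 1%:M xbar *m (col_mx 1%:M xbar)^T.

(* One block row of the product
     / f A B \                / w11 w12 \
     | . . . |  multiplied by | w21 W22 |
     \ . . . /                \ k1  K2  /
   for an arbitrary block row (c, C, D) of the left factor.  The closed-loop
   matrices use w = identity; the transformed ones use the blocks of the
   inverse of P. *)
Definition loop_row (R : realType) (p n m : nat)
    (c : 'cV[R]_p) (C : 'M[R]_(p, n)) (D : 'M[R]_(p, m))
    (w11 : 'M[R]_1) (w12 : 'rV[R]_n) (w21 : 'cV[R]_n) (W22 : 'M[R]_n)
    (k1 : 'cV[R]_m) (K2 : 'M[R]_(m, n)) : 'M[R]_(p, 1 + n) :=
  row_mx (row_mx c C) D *m col_mx (block_mx w11 w12 w21 W22) (row_mx k1 K2).

(* Main.v *)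
(* Each linear matrix inequality is a Schur complement of the corresponding
   condition after congruence with P_k^-1, because the transformed closed-loop
   rows are the original ones multiplied by P_k^-1.  With the prescribed Z the
   Schur complement in (L2) vanishes, so only its trace condition has content. *)
Require Import Defs.
From mathcomp Require Import all_boot all_order all_algebra.
From mathcomp Require Import reals.

Set Implicit Arguments.
Unset Strict Implicit.
Unset Printing Implicit Defensive.

Import Order.TTheory GRing.Theory Num.Theory.
Local Open Scope ring_scope.

Section Semidefinite.

Variable R : realType.

Lemma symmetricmxP (p : nat) (M : 'M[R]_p) :
  M \is symmetricmx <-> M^T = M.
Proof. by rewrite is_hermitianmxE expr0 scale1r map_mx_id // eq_sym; split=> /eqP. Qed.

Lemma psdmx_congr (p q : nat) (T : 'M[R]_(p, q)) (M : 'M[R]_p) :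
  psdmx M -> psdmx (T^T *m M *m T).
Proof.
move=> [/symmetricmxP sM M_ge0]; split.
  by apply/symmetricmxP; rewrite !trmx_mul trmxK sM mulmxA.
by move=> x; have := M_ge0 (T *m x); rewrite trmx_mul !mulmxA.
Qed.

(** Congruence by [V] undoes congruence by [T]. The two index types may differ, so that block
    permutations from [p + q] to [q + p] are covered. *)
Lemma psdmx_congr_iff (p q : nat) (T : 'M[R]_(p, q)) (V : 'M[R]_(q, p))
    (M : 'M[R]_p) :
  T *m V = 1%:M -> psdmx (T^T *m M *m T) <-> psdmx M.
Proof.
move=> TV; split; last exact: psdmx_congr.
move=> /(psdmx_congr V); rewrite !mulmxA -trmx_mul TV trmx1 mul1mx.
by rewrite -mulmxA TV mulmx1.
Qed.

Lemma pdmx_unit (p : nat) (M : 'M[R]_p) : pdmx M -> M \in unitmx.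
Proof.
move=> [_ M_gt0]; rewrite unitmxE unitfE; apply/det0P => -[v v0 vM].
have := M_gt0 v^T; rewrite trmx_eq0 trmxK vM mul0mx mxE ltxx.
by move=> /(_ v0).
Qed.

Lemma pdmx_psd (p : nat) (M : 'M[R]_p) : pdmx M -> psdmx M.
Proof.
move=> [sM M_gt0]; split=> // x; have [->|x0] := eqVneq x 0.
  by rewrite mulmx0 mxE.
exact/ltW/M_gt0.
Qed.

Lemma pdmx_tr (p : nat) (M : 'M[R]_p) : pdmx M -> M^T = M.
Proof. by move=> [/symmetricmxP]. Qed.

(** Substituting [y = invmx M *m x], the form of [invmx M] at [x] is the form of [M] at [y], and [y]
    vanishes only with [x]. *)
Lemma pdmx_inv (p : nat) (M : 'M[R]_p) : pdmx M -> pdmx (invmx M).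
Proof.
move=> Mpd; have uM := pdmx_unit Mpd; have sM := pdmx_tr Mpd.
split; first by apply/symmetricmxP; rewrite trmx_inv sM.
move=> x x0; have [_ /(_ (invmx M *m x))] := Mpd.
rewrite trmx_mul trmx_inv sM !mulmxA mulmxKV //; apply.
by apply: contra_neq x0 => /(congr1 (mulmx M)); rewrite mulmx0 mulKVmx.
Qed.

Lemma pdmx_scalar (p : nat) (c : R) : 0 < c -> pdmx (c%:M : 'M[R]_p).
Proof.
move=> c0; split; first by apply/symmetricmxP; rewrite tr_scalar_mx.
move=> x x0; rewrite mul_mx_scalar -scalemxAl mxE mulr_gt0 // mxE.
have [i xi0] : exists i, x i 0 != 0.
  apply/existsP; apply: contraNT x0 => /existsPn x_0.
  by apply/eqP/colP => i; rewrite mxE; apply/eqP/negPn/x_0.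
rewrite (bigD1 i) //= ltr_wpDr //.
  by apply: sumr_ge0 => j _; rewrite mxE -expr2 sqr_ge0.
by rewrite mxE -expr2 lt0r sqrf_eq0 xi0 sqr_ge0.
Qed.

Lemma quad_block_diag (p q : nat) (M : 'M[R]_p) (M' : 'M[R]_q)
    (x : 'cV[R]_(p + q)) :
  x^T *m block_mx M 0 0 M' *m x =
  (usubmx x)^T *m M *m usubmx x + (dsubmx x)^T *m M' *m dsubmx x.
Proof.
rewrite -{1 2}[x]vsubmxK tr_col_mx mul_row_block !mulmx0 addr0 add0r.
by rewrite mul_row_col.
Qed.

Lemma psdmx_block_diag (p q : nat) (M : 'M[R]_p) (M' : 'M[R]_q) :
  psdmx M -> psdmx (block_mx M 0 0 M') <-> psdmx M'.
Proof.
move=> [/symmetricmxP sM M_ge0]; split=> [[/symmetricmxP + D_ge0]|].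
  rewrite tr_block_mx => /eq_block_mx[_ _ _ sM']; split; first exact/symmetricmxP.
  (* Vectors with zero upper half isolate the form of [M']. *)
  move=> x; have := D_ge0 (col_mx 0 x).
  by rewrite quad_block_diag col_mxKu col_mxKd mulmx0 add0r.
move=> [/symmetricmxP sM' M'_ge0]; split.
  by apply/symmetricmxP; rewrite tr_block_mx !trmx0 sM sM'.
by move=> x; rewrite quad_block_diag mxE addr_ge0.
Qed.

Lemma pdmx_block_diag (p q : nat) (M : 'M[R]_p) (M' : 'M[R]_q) :
  pdmx M -> pdmx M' -> pdmx (block_mx M 0 0 M').
Proof.
move=> Mpd M'pd; have [_ M_ge0] := pdmx_psd Mpd; have [_ M'_ge0] := pdmx_psd M'pd.
split.
  by apply/symmetricmxP; rewrite tr_block_mx !trmx0 (pdmx_tr Mpd) (pdmx_tr M'pd).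
move=> x x0; rewrite quad_block_diag mxE.
have [ux0|ux0] := eqVneq (usubmx x) 0; last first.
  by apply: ltr_wpDr => //; apply: Mpd.2.
apply: ltr_wpDl => //; apply: M'pd.2; apply: contra_neq x0 => dx0.
by rewrite -[x]vsubmxK ux0 dx0 col_mx0.
Qed.

(** Block elimination: congruence by the unit upper triangular matrix with corner [invmx M *m Y]
    carries the block diagonal matrix of [M] and the Schur complement to the full matrix. The
    definite block [M] can then be dropped from the diagonal. *)
Lemma psdmx_schur_ul (p q : nat) (M : 'M[R]_p) (Y : 'M[R]_(p, q))
    (W : 'M[R]_q) :
  pdmx M ->
  psdmx (block_mx M Y Y^T W) <-> psdmx (W - Y^T *m invmx M *m Y).
Proof.
move=> Mpd; have uM := pdmx_unit Mpd; have sM := pdmx_tr Mpd.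
rewrite -(psdmx_block_diag (W - _) (pdmx_psd Mpd)).
pose T (X : 'M[R]_(p, q)) := block_mx 1%:M X 0 1%:M.
(* Negating the corner inverts a unit triangular block matrix, so the congruence is reversible. *)
have TT X : T X *m T (- X) = 1%:M.
  by rewrite mulmx_block !mulmx1 !mul0mx !mulmx0 !mul1mx !addr0 add0r addNr
             -scalar_mx_block.
rewrite -(psdmx_congr_iff (block_mx M 0 0 _) (TT (invmx M *m Y))).
suff -> : (T (invmx M *m Y))^T *m
    block_mx M 0 0 (W - Y^T *m invmx M *m Y) *m T (invmx M *m Y) =
    block_mx M Y Y^T W by [].
rewrite tr_block_mx !trmx1 !trmx0 trmx_mul trmx_inv sM !mulmx_block.
rewrite !mul1mx !mulmx1 !mul0mx !mulmx0 !addr0 !add0r.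
by rewrite -!mulmxA mulVmx // mulKVmx // mulmx1 addrC subrK.
Qed.

(** Exchanging the two blocks is congruence by a permutation matrix; it transfers the Schur
    complement from one diagonal block to the other. *)
Lemma psdmx_block_swap (p q : nat) (M : 'M[R]_p) (Y : 'M[R]_(p, q))
    (W : 'M[R]_q) :
  psdmx (block_mx M Y Y^T W) <-> psdmx (block_mx W Y^T Y M).
Proof.
pose T a b : 'M[R]_(a + b, b + a) := block_mx 0 1%:M 1%:M 0.
have TT : T p q *m T q p = 1%:M.
  by rewrite mulmx_block !mulmx1 !mul0mx !mulmx0 !addr0 !add0r -scalar_mx_block.
rewrite -(psdmx_congr_iff (block_mx M _ _ _) TT) tr_block_mx !trmx1 !trmx0.
by rewrite !mulmx_block !mul1mx !mulmx1 !mul0mx !mulmx0 !addr0 !add0r.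
Qed.

Lemma psdmx_schur_dr (p q : nat) (M : 'M[R]_p) (Y : 'M[R]_(p, q))
    (W : 'M[R]_q) :
  pdmx W ->
  psdmx (block_mx M Y Y^T W) <-> psdmx (M - Y *m invmx W *m Y^T).
Proof.
move=> /(psdmx_schur_ul Y^T M); rewrite trmxK => <-.
exact: psdmx_block_swap.
Qed.

(* Both sides are Schur complements of [[M^-1, 1], [1, M']]. *)
Lemma loewner_inv (p : nat) (M M' : 'M[R]_p) :
  pdmx M -> pdmx M' -> M \preceq M' <-> invmx M' \preceq invmx M.
Proof.
move=> Mpd M'pd; rewrite /loewner_le.
have := psdmx_schur_ul 1%:M M' (pdmx_inv Mpd).
have := psdmx_schur_dr (invmx M) 1%:M M'pd.
by rewrite trmx1 !mul1mx !mulmx1 invmxK => -> <-.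
Qed.

(** Congruence by the symmetric matrix [invmx M] sends [M] to [invmx M] and [X] to
    [invmx M *m X *m invmx M]. With [M] equal to [P k], the left side has the shape of the Schur
    complements in (L1) and (L4). *)
Lemma psdmx_congr_inv (p : nat) (M X : 'M[R]_p) :
  pdmx M -> psdmx (invmx M - invmx M *m X *m invmx M) <-> psdmx (M - X).
Proof.
move=> Mpd; have uM := pdmx_unit Mpd; have sM := pdmx_tr Mpd.
rewrite -(psdmx_congr_iff (M - X) (mulVmx uM)) trmx_inv sM.
by rewrite mulmxBr mulmxBl mulVmx // mul1mx.
Qed.

End Semidefinite.

(** Stacking [X] on [K *m X] gives the stack of the identity on [K], times [X]. With [X] the inverse
    of [P k], this is why the substitution for the gain makes the inequalities linear in the new
    variables. *)
Lemma loop_row_mul (R : realType) (p n m : nat)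
    (c : 'cV[R]_p) (C : 'M[R]_(p, n)) (D : 'M[R]_(p, m))
    (X : 'M[R]_(1 + n)) (K : 'M[R]_(m, 1 + n)) :
  loop_row c C D (ulsubmx X) (ursubmx X) (dlsubmx X) (drsubmx X)
    (lsubmx (K *m X)) (rsubmx (K *m X)) =
  loop_row c C D 1%:M 0 0 1%:M (lsubmx K) (rsubmx K) *m X.
Proof.
rewrite /loop_row submxK !hsubmxK -mulmxA mul_col_mx -scalar_mx_block.
by rewrite mul1mx.
Qed.

Theorem theorem1 (R : realType) (N n m s : nat)
  (q : nat -> nat) (r : nat -> 'I_s -> nat)
  (f : nat -> 'cV[R]_n) (A : nat -> 'M[R]_n) (B1 : nat -> 'M[R]_(n, m))
  (g1 : forall k, 'cV[R]_(q k)) (C1 : forall k, 'M[R]_(q k, n))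
  (D11 : forall k, 'M[R]_(q k, m))
  (g2 : forall k i, 'cV[R]_(r k i)) (C2 : forall k i, 'M[R]_(r k i, n))
  (D21 : forall k i, 'M[R]_(r k i, m))
  (xbar : 'cV[R]_n) (sqrtS : 'M[R]_(1 + n)) (Pf : 'M[R]_(1 + n))
  (P : nat -> 'M[R]_(1 + n)) (K : nat -> 'M[R]_(m, 1 + n)) (nu : R)
  (hsqrt : is_psd_sqrt sqrtS (Sigma0 xbar))
  (hPf : pdmx Pf)
  (hP : forall k, (k <= N)%N -> pdmx (P k))
  (hnu : 0 < nu) :
  (* closed-loop matrices *)
  let k1 k : 'cV[R]_m := lsubmx (K k) in
  let K2 k : 'M[R]_(m, n) := rsubmx (K k) in
  let fAK k := loop_row (f k) (A k) (B1 k) 1%:M 0 0 1%:M (k1 k) (K2 k) in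
  let gC1K k := loop_row (g1 k) (C1 k) (D11 k) 1%:M 0 0 1%:M (k1 k) (K2 k) in
  let gC2K k i :=
    loop_row (g2 k i) (C2 k i) (D21 k i) 1%:M 0 0 1%:M (k1 k) (K2 k) in
  let fK k : 'cV[R]_n := lsubmx (fAK k) in
  let AK k : 'M[R]_n := rsubmx (fAK k) in
  let g1K k : 'cV[R]_(q k) := lsubmx (gC1K k) in
  let C1K k : 'M[R]_(q k, n) := rsubmx (gC1K k) in
  let g2K k i : 'cV[R]_(r k i) := lsubmx (gC2K k i) in
  let C2K k i : 'M[R]_(r k i, n) := rsubmx (gC2K k i) in
  (* transformed variables *)
  let Pt k := invmx (P k) in
  let Kt k := K k *m invmx (P k) in
  let nut := nu^-1 in
  let Z := nu ^- 2 *: (sqrtS *m P 0%N *m sqrtS) in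
  let p11t k : 'M[R]_1 := ulsubmx (Pt k) in
  let p12t k : 'rV[R]_n := ursubmx (Pt k) in
  let p21t k : 'cV[R]_n := dlsubmx (Pt k) in
  let P22t k : 'M[R]_n := drsubmx (Pt k) in
  let k1t k : 'cV[R]_m := lsubmx (Kt k) in
  let K2t k : 'M[R]_(m, n) := rsubmx (Kt k) in
  let fAKt k := loop_row (f k) (A k) (B1 k)
    (p11t k) (p12t k) (p21t k) (P22t k) (k1t k) (K2t k) in
  let gC1Kt k := loop_row (g1 k) (C1 k) (D11 k)
    (p11t k) (p12t k) (p21t k) (P22t k) (k1t k) (K2t k) in
  let gC2Kt k i := loop_row (g2 k i) (C2 k i) (D21 k i)
    (p11t k) (p12t k) (p21t k) (P22t k) (k1t k) (K2t k) in
  let fKt k : 'cV[R]_n := lsubmx (fAKt k) in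
  let AKt k : 'M[R]_n := rsubmx (fAKt k) in
  let g1Kt k : 'cV[R]_(q k) := lsubmx (gC1Kt k) in
  let C1Kt k : 'M[R]_(q k, n) := rsubmx (gC1Kt k) in
  let g2Kt k i : 'cV[R]_(r k i) := lsubmx (gC2Kt k i) in
  let C2Kt k i : 'M[R]_(r k i, n) := rsubmx (gC2Kt k i) in
  (* (P1)-(P4) *)
  let E k := col_mx (block_mx 1%:M 0 0 1%:M)
    (col_mx (block_mx 1%:M 0 (fK k) (AK k)) (row_mx (g1K k) (C1K k))) in
  let P1 := forall k, (k < N)%N ->
    (E k)^T *m block_mx (- P k) 0 0 (block_mx (P k.+1) 0 0 1%:M) *m E k
      \preceq 0 in
  let P2 := \tr (P 0%N *m Sigma0 xbar) <= nu in
  let P3 := Pf \preceq P N in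
  let P4 := forall k i, (k < N)%N ->
    nu *: ((row_mx (g2K k i) (C2K k i))^T *m row_mx (g2K k i) (C2K k i))
      \preceq P k in
  (* (L1)-(L4) *)
  let L1 := forall k, (k < N)%N ->
    0 \preceq
    block_mx
      (block_mx (block_mx (p11t k.+1) (p12t k.+1) (p21t k.+1) (P22t k.+1))
                0
                0
                1%:M)
      (col_mx (block_mx (p11t k) (p12t k) (fKt k) (AKt k))
              (row_mx (g1Kt k) (C1Kt k)))
      (row_mx (block_mx (p11t k) (fKt k)^T (p21t k) (AKt k)^T)
              (col_mx (g1Kt k)^T (C1Kt k)^T))
      (block_mx (p11t k) (p12t k) (p21t k) (P22t k)) in
  let L2 :=
    0 \preceq block_mx (Pt 0%N) (nut *: sqrtS) (nut *: sqrtS^T) Z /\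
    \tr Z <= nut in
  let L3 := Pt N \preceq invmx Pf in
  let L4 := forall k i, (k < N)%N ->
    0 \preceq
    block_mx (block_mx (p11t k) (p12t k) (p21t k) (P22t k))
             (col_mx (g2Kt k i)^T (C2Kt k i)^T)
             (row_mx (g2Kt k i) (C2Kt k i))
             nut%:M in
  [/\ P1, P2, P3 & P4] <-> [/\ L1, L2, L3 & L4].
Proof.
move=> k1 K2 fAK gC1K gC2K fK AK g1K C1K g2K C2K Pt Kt nut Z p11t p12t p21t
  P22t k1t K2t fAKt gC1Kt gC2Kt fKt AKt g1Kt C1Kt g2Kt C2Kt E P1 P2 P3 P4
  L1 L2 L3 L4.
have nut0 : 0 < nut by rewrite invr_gt0.
have [/symmetricmxP sS _] := hsqrt.1.
have PtK k : block_mx (p11t k) (p12t k) (p21t k) (P22t k) = Pt k.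
  exact: submxK.
have sPt k : (k <= N)%N -> (Pt k)^T = Pt k.
  by move=> kN; rewrite trmx_inv (pdmx_tr (hP _ kN)).
have HfAK k : row_mx (fKt k) (AKt k) = row_mx (fK k) (AK k) *m Pt k.
  by rewrite !hsubmxK /fAKt loop_row_mul.
have HgC1K k : row_mx (g1Kt k) (C1Kt k) = row_mx (g1K k) (C1K k) *m Pt k.
  by rewrite !hsubmxK /gC1Kt loop_row_mul.
have HgC2K k i :
    row_mx (g2Kt k i) (C2Kt k i) = row_mx (g2K k i) (C2K k i) *m Pt k.
  by rewrite !hsubmxK /gC2Kt loop_row_mul.
have PL1 : P1 <-> L1.
  have step k : (k < N)%N ->
      ((E k)^T *m block_mx (- P k) 0 0 (block_mx (P k.+1) 0 0 1%:M) *m E k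
         \preceq 0) <->
      0 \preceq
      block_mx
        (block_mx (block_mx (p11t k.+1) (p12t k.+1) (p21t k.+1) (P22t k.+1))
                  0 0 1%:M)
        (col_mx (block_mx (p11t k) (p12t k) (fKt k) (AKt k))
                (row_mx (g1Kt k) (C1Kt k)))
        (row_mx (block_mx (p11t k) (fKt k)^T (p21t k) (AKt k)^T)
                (col_mx (g1Kt k)^T (C1Kt k)^T))
        (block_mx (p11t k) (p12t k) (p21t k) (P22t k)).
    (* The bound [k < N] is by definition [k.+1 <= N], so it also gives definiteness of [P k.+1]. *)
    move=> kN; have Pk := hP _ (ltnW kN); have Pk1 := hP _ kN.
    (* [F] collects the rows of [E k] below its leading identity, so that (P1) says that [P k]
       dominates [F^T diag(P k.+1, I) F]. *)
    pose F := col_mx (block_mx 1%:M 0 (fK k) (AK k)) (row_mx (g1K k) (C1K k)).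
    have EF : E k = col_mx 1%:M F by rewrite /E -scalar_mx_block.
    (* The row (1 0) of [F] picks out the first row of [Pt k]; the other rows are the closed-loop
       ones times [Pt k]. *)
    have YF : col_mx (block_mx (p11t k) (p12t k) (fKt k) (AKt k))
                (row_mx (g1Kt k) (C1Kt k)) = F *m Pt k.
      rewrite /F mul_col_mx HgC1K block_mxEv HfAK (block_mxEv 1%:M) mul_col_mx.
      congr (col_mx (col_mx _ _) _).
      by rewrite -[Pt k in RHS]submxK mul_row_block !mul1mx !mul0mx !addr0.
    (* Symmetry of [Pt k] makes the lower left block the transpose of the upper right one, as the
       Schur complement requires. *)
    have YFT : row_mx (block_mx (p11t k) (fKt k)^T (p21t k) (AKt k)^T)
                (col_mx (g1Kt k)^T (C1Kt k)^T) = (F *m Pt k)^T.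
      have p11T : (p11t k)^T = p11t k by rewrite trmx_ulsub (sPt _ (ltnW kN)).
      have p12T : (p12t k)^T = p21t k by rewrite trmx_ursub (sPt _ (ltnW kN)).
      by rewrite -YF tr_col_mx tr_block_mx tr_row_mx p11T p12T.
    rewrite /loewner_le sub0r subr0 !PtK YF YFT.
    rewrite psdmx_schur_ul; last first.
      by apply: pdmx_block_diag; [exact: pdmx_inv | exact: pdmx_scalar].
    have -> : invmx (block_mx (Pt k.+1) 0 0 (1%:M : 'M_(q k))) =
        block_mx (P k.+1) 0 0 1%:M.
      rewrite invmx_block_diag ?invmxK ?invmx1 // block_diag_mx_unit.
      by rewrite unitmx_inv pdmx_unit // unitmx1.
    (* Reassociation brings the complement to the form [Pt k - Pt k X Pt k] with
       [X = F^T diag(P k.+1, I) F]; the congruence then leaves [P k - X], which is minus the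
       quadratic expression in (P1). *)
    rewrite trmx_mul (sPt _ (ltnW kN)) -!mulmxA (mulmxA F^T) (mulmxA (F^T *m _)).
    rewrite (mulmxA (Pt k)) psdmx_congr_inv // EF tr_col_mx trmx1.
    rewrite mulmxA mul_row_block !mulmx0 addr0 add0r mul1mx mul_row_col mulmx1.
    by rewrite opprD opprK.
  by split=> H k kN; apply/step => //; apply: H.
have PL2 : P2 <-> L2.
  (* Cyclicity of the trace joins the two square roots into [Sigma0 xbar]. *)
  have trE : \tr Z = nut ^+ 2 * \tr (P 0%N *m Sigma0 xbar).
    by rewrite /Z mxtraceZ -exprVn -hsqrt.2 -mulmxA mxtrace_mulC -mulmxA.
  (* One factor [nut] cancels against the bound, and the other moves across as [nu]. *)
  have trP : (\tr Z <= nut) = (\tr (P 0%N *m Sigma0 xbar) <= nu).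
    by rewrite trE expr2 -mulrA ger_pMr // mulrC ler_pdivrMr // mul1r.
  rewrite /L2 trP; split=> [H|[]//]; split=> //.
  have P0 := hP _ (leq0n N).
  rewrite /loewner_le subr0.
  have sT : (nut *: sqrtS)^T = nut *: sqrtS by rewrite linearZ /= sS.
  (* Only the lower left block is written as a transpose, to match the Schur complement pattern. *)
  rewrite sS -{2}sT.
  rewrite psdmx_schur_ul ?invmxK; last exact: pdmx_inv.
  (* The term subtracted from [Z] is [nu^-2 sqrtS P_0 sqrtS], which is [Z] itself. *)
  rewrite sT -!scalemxAl -!scalemxAr scalerA -expr2 exprVn subrr.
  split; first by apply/symmetricmxP; rewrite trmx0.
  by move=> x; rewrite mulmx0 mul0mx mxE.
(* Inversion reverses the Loewner order on positive definite matrices. *)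
have PL3 : P3 <-> L3 by apply: loewner_inv => //; exact: hP.
have PL4 : P4 <-> L4.
  have step k i : (k < N)%N ->
      (nu *: ((row_mx (g2K k i) (C2K k i))^T *m row_mx (g2K k i) (C2K k i))
        \preceq P k) <->
      0 \preceq
      block_mx (block_mx (p11t k) (p12t k) (p21t k) (P22t k))
             (col_mx (g2Kt k i)^T (C2Kt k i)^T)
             (row_mx (g2Kt k i) (C2Kt k i))
             nut%:M.
    move=> kN; have Pk := hP _ (ltnW kN).
    rewrite /loewner_le subr0 PtK -tr_row_mx.
    (* The double transpose exposes the pair [Y], [Y^T]. Here the complement is taken with respect
       to the lower right block [nut%:M], whose inverse supplies the factor [nu] of (P4). *)
    rewrite -[row_mx (g2Kt k i) _ in X in block_mx _ _ X _]trmxK.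
    rewrite psdmx_schur_dr; last exact: pdmx_scalar.
    rewrite trmxK HgC2K trmx_mul (sPt _ (ltnW kN)) invmx_scalar invrK.
    rewrite mul_mx_scalar -scalemxAl -!mulmxA (mulmxA _^T).
    (* The scalar [nu] is moved between the two factors [Pt k], so that the congruence applies with
       [X] the left side of (P4). *)
    rewrite [nu *: (Pt k *m _)]scalemxAr [nu *: (_ *m Pt k)]scalemxAl.
    by rewrite (mulmxA (Pt k)) psdmx_congr_inv.
  by split=> H k i kN; apply/step => //; apply: H.
by split=> -[H1 H2 H3 H4]; split;
  [exact/PL1 | exact/PL2 | exact/PL3 | exact/PL4
  |exact/PL1 | exact/PL2 | exact/PL3 | exact/PL4].
Qed.
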